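(* Let $T(\mathcal{E})$ be a translation generalised quadrangle of order $(s,t)$, with $s$ a power of the prime $p$. Then the minimum weight codewords of the $p$-ary code of points and lines of $T(\mathcal{E})$ are precisely the nonzero scalar multiples of the incidence vectors of lines of $T(\mathcal{E})$.
   Context: Translation generalised quadrangles: let $q$ be a power of a prime. An egg $\mathcal{E}$ in $\mathrm{PG}(2n+m-1,q)$ ($n,m\geq 1$) is a set of $q^m+1$ subspaces, each of dimension $n-1$, such that any three different elements span a $(3n-1)$-dimensional subspace, and each $E\in\mathcal{E}$ is contained in an $(n+m-1)$-dimensional subspace $T_E$ (the tangent space at $E$) which is disjoint from every element of $\mathcal{E}\setminus\{E\}$. Embed $\mathrm{PG}(2n+m-1,q)$ as a hyperplane $H_\infty$ in $\Pi\cong\mathrm{PG}(2n+m,q)$. The points of the incidence structure $T(\mathcal{E})$ are: (i) the points of $\Pi\setminus H_\infty$; (ii) the $(n+m)$-dimensional subspaces of $\Pi$ intersecting $H_\infty$ in a tangent space of $\mathcal{E}$; (iii) a symbol $(\infty)$. The lines are: (a) the $n$-dimensional subspaces of $\Pi$ intersecting $H_\infty$ in an element of $\mathcal{E}$; (b) the elements of $\mathcal{E}$. Incidence: $(\infty)$ is incident with all lines of type (b) and no line of type (a); a point of type (ii) is incident with the lines of type (a) contained in it and with the unique line of type (b) contained in it; a point of type (i) is incident with the lines of type (a) containing it and with no line of type (b). $T(\mathcal{E})$ is a generalised quadrangle of order $(s,t)=(q^n,q^m)$, i.e. every line has $s+1$ points, every point is on $t+1$ lines, two distinct points are on at most one common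 line, and for each point $P$ and line $L$ not through $P$ there is exactly one line through $P$ meeting $L$. Every translation generalised quadrangle is isomorphic to $T(\mathcal{E})$ for some egg $\mathcal{E}$. The $p$-ary code of points and lines: let $N$ be the incidence matrix with rows indexed by lines and columns indexed by points; the code is the $\mathbb{F}_p$-span of the rows of $N$. The incidence vector of a line is the corresponding row of $N$. Minimum weight means the smallest Hamming weight of a nonzero codeword. *)

(* Defs.v *)
From HB Require Import structures.
From mathcomp Require Import all_boot all_order all_algebra.

Set Implicit Arguments.
Unset Strict Implicit.
Unset Printing Implicit Defensive.

Import GRing.Theory.
Local Open Scope ring_scope.

(* The library does not declare {vspace V} finite when V is a vector space    *)
(* over a finite field.                                                       *)
HB.instance Definition _ (F : finFieldType) (V : vectType F) :
    isCountable {vspace V} :=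
  CanIsCountable (@VectorInternalTheory.vs2mxK F V).
HB.instance Definition _ (F : finFieldType) (V : vectType F) :
    isFinite {vspace V} :=
  CanIsFinite (@VectorInternalTheory.vs2mxK F V).

(* Projective subspaces are represented by vector subspaces, so dimensions    *)
(* are vectorial: one more than the projective dimension.                     *)
Section TranslationGQ.

Variables (F : finFieldType) (V : vectType F) (n m : nat).

(* W is the ambient PG(2n+m-1,q) of the egg A, as a subspace of V. *)
Variables (W : {vspace V}) (A : {set {vspace V}}).

Definition is_tangent_at (E U : {vspace V}) : bool :=
  [&& (E <= U)%VS, (U <= W)%VS, \dim U == (n + m)%N
    & [forall E' in A, (E' != E) ==> ((E' :&: U)%VS == 0%VS)]].

Definition is_tangent (U : {vspace V}) : bool :=
  [exists E in A, is_tangent_at E U].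

Definition is_egg : Prop :=
  [/\ #|A| = (#|F| ^ m + 1)%N,
      forall E, E \in A -> (E <= W)%VS /\ \dim E = n,
      forall E1 E2 E3, E1 \in A -> E2 \in A -> E3 \in A ->
        E1 != E2 -> E1 != E3 -> E2 != E3 -> \dim (E1 + E2 + E3) = (3 * n)%N
    & forall E, E \in A -> exists U, is_tangent_at E U].

Definition affine_point : finType :=
  {x : {vspace V} | (\dim x == 1%N) && ~~ (x <= W)%VS}.

Definition tangent_point : finType :=
  {U : {vspace V} | (\dim U == (n + m).+1) && is_tangent (U :&: W)%VS}.

Definition affine_line : finType :=
  {l : {vspace V} | (\dim l == n.+1) && ((l :&: W)%VS \in A)}.

Definition egg_line : finType := {E : {vspace V} | E \in A}.

(* The last summand is the symbol (oo). *)
Definition tgq_point : finType := (affine_point + tangent_point + unit)%type.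

Definition tgq_line : finType := (affine_line + egg_line)%type.

Definition tgq_inc (P : tgq_point) (L : tgq_line) : bool :=
  match P, L with
  | inl (inl x), inl l => (val x <= val l)%VS
  | inl (inl _), inr _ => false
  | inl (inr U), inl l => (val l <= val U)%VS
  | inl (inr U), inr E => (val E <= val U)%VS
  | inr _, inl _ => false
  | inr _, inr _ => true
  end.

End TranslationGQ.

Section Code.

Variables (K : fieldType) (P L : finType) (inc : P -> L -> bool).

Definition incidence_mx : 'M[K]_(#|L|, #|P|) :=
  \matrix_(i, j) (inc (enum_val j) (enum_val i))%:R.

Definition incidence_vector (l : L) : 'rV[K]_#|P| :=
  row (enum_rank l) incidence_mx.

Definition codeword (c : 'rV[K]_#|P|) : Prop := (c <= incidence_mx)%MS.

End Code.

Definition hamming_weight (K : fieldType) (k : nat) (c : 'rV[K]_k) : nat :=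
  #|[set j | c 0 j != 0]|.

Definition min_weight_codeword (K : fieldType) (P L : finType)
    (inc : P -> L -> bool) (c : 'rV[K]_#|P|) : Prop :=
  [/\ codeword inc c, c != 0
    & forall c' : 'rV[K]_#|P|, codeword inc c' -> c' != 0 ->
        (hamming_weight c <= hamming_weight c')%N].

(* Main.v *)
Require Import Defs.
From HB Require Import structures.
From mathcomp Require Import all_boot all_order all_algebra.
From mathcomp Require Import finfield zify.

Set Implicit Arguments.
Unset Strict Implicit.
Unset Printing Implicit Defensive.

Import GRing.Theory.
Local Open Scope ring_scope.

(* Write s = q ^ n, t = q ^ m and let c be a nonzero codeword of weight at    *)
(* most s + 1. Two families of dual codewords suffice. For an affine subspace *)
(* X with direction D of dimension n + m, the sum of c over X equals the sum  *)
(* of c over the tangent points whose egg element misses D; so it is the same *)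
(* for all translates of X. For an affine point P, the difference of the      *)
(* perps of P and (oo) is a dual word.                                        *)
(* If c is nonzero at an affine point x, a Bose-Burton count gives X through  *)
(* x containing no other support point, so each of the s translates of X      *)
(* meets the support; the support then consists of s affine points and one    *)
(* tangent point U, over the egg element E say. Using all D complementary to  *)
(* E, the affine part is a constant multiple of a line l through E.           *)
(* Subtracting that multiple of l leaves a codeword without affine support.   *)
(* If c has no affine support, the first family shows that c sums to 0 over   *)
(* the tangent points at each egg element (an exceptional case, in which all  *)
(* these sums are equal and nonzero, needs t <= s and is excluded by a D      *)
(* inside the span of two egg elements), and then the second one that it sums *)
(* to c (oo) over the tangent points through any affine point; counting the   *)
(* intersections of tangent points forces c to be a multiple of a line of     *)
(* type (b).                                                                  *)

(** * Finite vector spaces *)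

(** A line has q ^ n + 1 points, so it is enough that a nonzero codeword of weight at most q ^ n + 1
    is a multiple of a line ([small_weight_line]). Dual words exist because a subspace with affine
    points has a power of q of them, which is 1 or 0 in K. This yields the relations
    [code_subspace_sum], where a line complementary to X meets it exactly once, and [code_perp_sum],
    which rests on [tangent_partition]. With an affine support point ([line_of_affine_support]),
    [subspace_avoiding] isolates that point in a coset, and [transversal_card] then leaves room for
    only one point of the support off the affine part. Without one ([line_of_support_at_infinity]),
    [sum_tangent] and [tangent_const] make the codeword constant on a line of type (b). *)

Section FiniteVectorSpace.

Variables (F : finFieldType) (V : vectType F).
Local Notation q := #|F|.
Implicit Types (X D W : {vspace V}) (v w : V).

Definition vset X : {set finvect_type V} := [set v : finvect_type V | (v :
  V) \in X].

Lemma in_vset X v : ((v : finvect_type V) \in vset X) = (v \in X).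
Proof. by rewrite inE. Qed.

Lemma card_vset X : #|vset X| = (q ^ \dim X)%N.
Proof.
rewrite cardsE; case: V X => T cT X.
exact: (@card_vspace F (finvect_type (Vector.Pack cT)) cT X).
Qed.

Lemma card_field_gt1 : (1 < q)%N.
Proof. exact: finNzRing_gt1. Qed.

Lemma card_field_gt0 : (0 < q)%N.
Proof. exact: ltnW card_field_gt1. Qed.

Lemma dimv_add_line D v : v \notin D -> \dim (D + <[v]>) = (\dim D).+1.
Proof.
move=> vD; rewrite dimv_disjoint_sum ?dim_vline.
  by case: eqVneq vD => [->|_ _]; rewrite ?mem0v // addn1.
apply/eqP; rewrite -subv0; apply/subvP => w /memv_capP[wD /vlineP[k wE]].
rewrite memv0 wE; case: (eqVneq k 0) => [->|k0]; first by rewrite scale0r.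
by case/negP: vD; rewrite -[v](scalerK k0) -wE memvZ.
Qed.

Lemma mem_add_line_exchange D v w :
  v \notin D -> v \in (D + <[w]>)%VS -> w \in (D + <[v]>)%VS.
Proof.
move=> vD /memv_addP[d dD [_ /vlineP[k ->] vE]].
have k0 : k != 0.
  by apply: contraNneq vD => k0; rewrite vE k0 scale0r addr0.
rewrite -[w](scalerK k0) memvZ //.
have -> : k *: w = - d + v by rewrite vE addKr.
by rewrite memv_add ?memvN ?memv_line.
Qed.

Lemma subspace_avoiding (I : finType) (J : {set I}) (y : I -> V) W k d :
  (#|J| * (q - 1) < q ^ k.+1 - 1)%N -> (forall i, i \in J -> y i != 0) ->
  (k + d <= \dim W)%N ->
  exists2 D, (D <= W)%VS /\ \dim D = d & forall i, i \in J -> y i \notin D.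
Proof.
move=> ltJ yn0; elim: d => [|d IHd] ledW.
  by exists 0%VS; [rewrite sub0v dimv0 | move=> i /yn0; rewrite memv0].
have [|D [DW dD] yD] := IHd; first by lia.
pose B i := vset (D + <[y i]>) :\: vset D.
have [w wW wB] : exists2 w, w \in W & w \notin D /\
    forall i, i \in J -> w \notin (D + <[y i]>)%VS.
  have [/subsetP sub|/subsetPn[w]] :=
      boolP (vset W \subset vset D :|: \bigcup_(i in J) B i); last first.
    rewrite in_vset !inE negb_or => wW /andP[wD /bigcupP wB].
    exists w => //; split => // i iJ; apply/negP => wi.
    by case: wB; exists i; rewrite // !inE wD.
  have /subset_leq_card/leq_trans/(_ (leq_card_setU _ _)) :
    vset W \subset vset D :|: \bigcup_(i in J) B i by apply/subsetP.
  have : (#|\bigcup_(i in J) B i| <= #|J| * (q ^ d.+1 - q ^ d))%N.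
    rewrite -sum_nat_const; apply: leq_trans (_ : \sum_(i in J) #|B i| <= _)%N.
      elim/big_rec2: _ => [|i c U _ leU]; first by rewrite cards0.
      by rewrite (leq_trans (leq_card_setU _ _)) ?leq_add2l.
    apply: leq_sum => i iJ; rewrite cardsD (setIidPr _).
      by rewrite !card_vset dimv_add_line ?yD // dD.
    by apply/subsetP => v; rewrite !in_vset; apply: subvP (addvSl _ _) _.
  rewrite !card_vset dD => le1 le2.
  have q0 : (0 < q)%N := card_field_gt0.
  have leW : (q ^ (k + d.+1) <= q ^ \dim W)%N by rewrite leq_pexp2l.
  have : (#|J| * (q - 1) * q ^ d < (q ^ k.+1 - 1) * q ^ d)%N.
    by rewrite ltn_pmul2r ?expn_gt0 ?q0.
  have -> : (#|J| * (q - 1) * q ^ d = #|J| * (q ^ d.+1 - q ^ d))%N.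
    by rewrite -mulnA mulnBl mul1n -expnS.
  rewrite mulnBl mul1n -expnD addSnnS.
  lia.
exists (D + <[w]>)%VS.
  rewrite dimv_add_line ?dD; last by case: wB.
  by split=> //; rewrite subv_add DW -memvE.
move=> i iJ; apply/negP => /(mem_add_line_exchange (yD i iJ)).
by apply/negP; case: wB => _; apply.
Qed.

End FiniteVectorSpace.

(** * Affine points as vectors *)

Section AffinePoints.

Variables (F : finFieldType) (V : vectType F) (W : {vspace V}).
Hypothesis hypW : \dim {:V} = (\dim W).+1.
Local Notation q := #|F|.
Local Notation aP := (affine_point W).
Implicit Types (X D : {vspace V}) (x y : aP).

Let v0 : V := vpick W^C.

Let v0_notin : v0 \notin W.
Proof.
apply/negP => v0W; have :
  v0 \in (W :&: W^C)%VS by rewrite memv_cap v0W memv_pick.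
rewrite capv_compl memv0 vpick0 -dimv_eq0 dimv_compl hypW; lia.
Qed.

Lemma notin_spans u : u \notin W -> (W + <[u]>)%VS = fullv.
Proof. by move=> uW; apply/eqP; rewrite eqEdim subvf hypW dimv_add_line /=. Qed.

Lemma aP_notin x u : u \in val x -> u != 0 -> u \notin W.
Proof.
move=> ux u0; apply: contra (proj2 (andP (valP x))) => uW.
suff -> : val x = <[u]>%VS by rewrite -memvE.
apply/esym/eqP; rewrite eqEdim -memvE ux dim_vline u0.
by rewrite (eqP (proj1 (andP (valP x)))).
Qed.

Let rep_ex x : exists u, (u \in val x) && (u - v0 \in W).
Proof.
have x0 : vpick (val x) != 0.
  by rewrite vpick0 -dimv_eq0 (eqP (proj1 (andP (valP x)))).
have /memv_addP[w wW [_ /vlineP[k ->] v0E]] : v0 \in (W + <[vpick (val x)]>)%VS.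
  by rewrite notin_spans ?memvf // (aP_notin (memv_pick _)).
by exists (k *: vpick (val x));
  rewrite memvZ ?memv_pick //= v0E opprD addrCA subrr addr0 memvN.
Qed.

(* Vectors spanning the affine points, normalised so that they all lie in the *)
(* same translate of W; differences of affine points then make sense.         *)
Definition rep x : V := xchoose (rep_ex x).

Lemma mem_rep x : rep x \in val x.
Proof. by case/andP: (xchooseP (rep_ex x)). Qed.

Let rep_v0 x : rep x - v0 \in W.
Proof. by case/andP: (xchooseP (rep_ex x)). Qed.

Lemma rep_notin x : rep x \notin W.
Proof.
by apply: contra v0_notin => xW; rewrite -memvN -(rpredDl _ xW) rep_v0.
Qed.

Lemma repB x y : rep x - rep y \in W.
Proof. by rewrite -(subrKA v0) rpredD // -opprB memvN. Qed.

Lemma val_rep x : val x = <[rep x]>%VS.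
Proof.
apply/esym/eqP; rewrite eqEdim -memvE mem_rep dim_vline.
rewrite (eqP (proj1 (andP (valP x)))).
by case: eqVneq (rep_notin x) => [->|]; rewrite ?mem0v.
Qed.

Lemma sub_rep x X : (val x <= X)%VS = (rep x \in X).
Proof. by rewrite memvE val_rep. Qed.

Lemma rep_inj : injective rep.
Proof. by move=> x y xy; apply: val_inj; rewrite !val_rep xy. Qed.

Let rep_surj u : u - v0 \in W -> exists x, rep x = u.
Proof.
move=> uv0; have uW : u \notin W.
  by apply: contra v0_notin => uW; rewrite -memvN -(rpredDl _ uW).
have u0 : u != 0 by apply: contraNneq uW => ->; rewrite mem0v.
have xP : (\dim <[u]> == 1%N) && ~~ (<[u]> <= W)%VS by rewrite dim_vline u0
  -memvE.
exists (Sub <[u]>%VS xP); set x : aP := Sub _ _.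
have /vlineP[k kE] : rep x \in <[u]>%VS by exact: mem_rep.
have : rep x - u \in W by rewrite -(subrKA v0) rpredD // -opprB memvN.
rewrite kE -[X in _ - X]scale1r -scalerBl => kW.
have [/eqP|k1] := eqVneq (k - 1) 0; first by rewrite subr_eq0 => /eqP->;
  rewrite scale1r.
by case/negP: uW; rewrite -[u](scalerK k1) memvZ.
Qed.

Lemma ex_translate x w : w \in W -> exists y, rep y = rep x + w.
Proof. by move=> wW; apply: rep_surj; rewrite addrAC rpredD. Qed.

Lemma sub_aff X x y : (val x <= X)%VS ->
  (val y <= X)%VS = (rep y - rep x \in (X :&: W)%VS).
Proof. by rewrite !sub_rep => xX; rewrite memv_cap repB andbT rpredBr. Qed.

Lemma ex_aff X : ~~ (X <= W)%VS -> exists x, (val x <= X)%VS.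
Proof.
move=> XW; have /subvPn[u uX uW] := XW.
have [k [k0 kE]] : exists k, k != 0 /\ k *: u - v0 \in W.
  have : v0 \in (W + <[u]>)%VS by rewrite notin_spans ?memvf.
  case/memv_addP=> w wW [_ /vlineP[k ->] v0E].
  exists k; split; last by rewrite v0E opprD addrCA subrr addr0 memvN.
  by apply: contraNneq v0_notin => k0; rewrite v0E k0 scale0r addr0.
by have [x xE] := rep_surj kE; exists x; rewrite sub_rep xE memvZ.
Qed.

Lemma card_aff X x : (val x <= X)%VS ->
  #|[set y : aP | (val y <= X)%VS]| = (q ^ \dim (X :&: W))%N.
Proof.
move=> xX; rewrite -card_vset.
have injB : injective (fun y => rep y - rep x : finvect_type V).
  by move=> y z /addIr/rep_inj.
rewrite -(card_imset _ injB); apply: eq_card => u.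
rewrite inE; apply/imsetP/idP => [[y] | uXW].
  by rewrite inE (sub_aff _ xX) => yX ->.
have [|y yE] := @ex_translate x u; first by case/memv_capP: uXW.
by exists y; rewrite ?inE ?(sub_aff y xX) yE addrC addKr.
Qed.

Lemma sub_W_aff X x : (val x <= X)%VS -> ~~ (X <= W)%VS.
Proof. by rewrite sub_rep => xX; apply: contra (rep_notin x) => /subvP->. Qed.

Lemma dim_cap_hyp X : ~~ (X <= W)%VS -> \dim X = (\dim (X :&: W)).+1.
Proof.
move=> XW; have /subvPn[u uX uW] := XW.
have XWf : (X + W)%VS = fullv.
  by apply/eqP; rewrite eqEsubv subvf /= -(notin_spans uW) addvC addvS //
    -memvE.
by have := dimv_sum_cap X W; rewrite XWf hypW; lia.
Qed.

Lemma cap_join x D : (D <= W)%VS -> ((val x + D) :&: W)%VS = D.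
Proof.
move=> DW; apply/eqP; rewrite eqEsubv subv_cap DW addvSr !andbT.
apply/subvP => u /memv_capP[/memv_addP[a ax [d dD ->]] uW].
have aW : a \in W by rewrite -(rpredDr _ (subvP DW d dD)).
have [->|a0] := eqVneq a 0; first by rewrite add0r.
by case/negP: (aP_notin ax a0).
Qed.

Lemma dim_join x D : (D <= W)%VS -> \dim (val x + D) = (\dim D).+1.
Proof.
move=> DW; rewrite dim_cap_hyp ?cap_join //.
exact: sub_W_aff (addvSl _ _).
Qed.

Lemma sub_join x y D : (D <= W)%VS ->
  (val y <= val x + D)%VS = (rep y - rep x \in D).
Proof. by move=> DW; rewrite (sub_aff _ (addvSl _ _)) cap_join. Qed.

Lemma join_cap x X : (val x <= X)%VS -> X = (val x + X :&: W)%VS.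
Proof.
move=> xX; apply/esym/eqP; rewrite eqEdim subv_add xX capvSl /=.
by rewrite dim_join ?capvSr // (dim_cap_hyp (sub_W_aff xX)).
Qed.

Lemma card_aff_all : #|aP| = (q ^ \dim W)%N.
Proof.
have [|x _] := @ex_aff fullv.
  by apply/negP => /dimvS; rewrite hypW ltnn.
have := card_aff (subvf (val x)); rewrite capfv => <-.
by rewrite -cardsT; apply: eq_card => y; rewrite !inE subvf.
Qed.

End AffinePoints.

(** * Codewords as functions on points *)

Section CodeFunctions.

Variables (K : fieldType) (P L : finType) (inc : P -> L -> bool).
Implicit Types (g v : P -> K).

(** Codewords as functions on points, so that sums split by point type. *)
Definition code_function g : Prop :=
  exists d : L -> K, forall x, g x = \sum_l d l * (inc x l)%:R.

Definition weight g : nat := #|[set x | g x != 0]|.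

Lemma code_function_dual g v : code_function g ->
  (forall l, \sum_(x | inc x l) v x = 0) -> \sum_x g x * v x = 0.
Proof.
move=> [d gE] v0; under eq_bigr => x _ do rewrite gE mulr_suml.
rewrite exchange_big /= big1 // => l _.
rewrite (eq_bigr (fun x => d l * ((inc x l)%:R * v x))); last first.
  by move=> x _; rewrite mulrA.
rewrite -mulr_sumr; have := v0 l; rewrite big_mkcond => v0l.
suff -> : \sum_x (inc x l)%:R * v x = 0 by rewrite mulr0.
by rewrite -{}[RHS]v0l; apply: eq_bigr => x _; case: (inc x l);
  rewrite ?mul1r ?mul0r.
Qed.

Lemma code_function_sub_line g a l : code_function g ->
  code_function (fun x => g x - a * (inc x l)%:R).
Proof.
move=> [d gE]; exists (fun l' => d l' - a * (l' == l)%:R) => x.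
under eq_bigr => l' _ do rewrite mulrBl.
rewrite sumrB -gE; congr (_ - _);
  rewrite (bigD1 l) //= eqxx mulr1 big1 ?addr0 //.
by move=> l' /negPf->; rewrite mulr0 mul0r.
Qed.

Lemma incidence_vectorE l j :
  incidence_vector K inc l 0 j = (inc (enum_val j) l)%:R.
Proof. by rewrite !mxE enum_rankK. Qed.

Lemma codeword_function (c : 'rV[K]_#|P|) : codeword inc c ->
  code_function (fun x => c 0 (enum_rank x)).
Proof.
case/submxP => D ->; exists (fun l => D 0 (enum_rank l)) => x.
rewrite mxE (reindex enum_rank) /=; last exact/onW_bij/enum_rank_bij.
by apply: eq_bigr => l _; rewrite mxE !enum_rankK.
Qed.

Lemma hamming_weight_function (c : 'rV[K]_#|P|) :
  hamming_weight c = weight (fun x => c 0 (enum_rank x)).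
Proof.
rewrite /hamming_weight /weight -(card_imset _ (@enum_rank_inj P)).
apply: eq_card => j; apply/idP/imsetP => [|[x + ->]]; rewrite !inE //.
by exists (enum_val j); rewrite ?inE enum_valK.
Qed.

End CodeFunctions.

(** * Eggs and tangent spaces *)

Lemma sum_mem_card (T : finType) (S B : {set T}) :
  (\sum_(w in S) (w \in B) = #|B :&: S|)%N.
Proof.
rewrite -sum1_card big_mkcond [RHS]big_mkcond; apply: eq_bigr => w _.
by rewrite inE; case: (w \in S); case: (w \in B).
Qed.

Section TranslationQuadrangle.

Variables (F : finFieldType) (V : vectType F) (n m : nat).
Variables (W : {vspace V}) (A : {set {vspace V}}).
Hypotheses (n_gt0 : (0 < n)%N) (m_gt0 : (0 < m)%N).
Hypotheses (dimV : \dim {:V} = (2 * n + m).+1) (dimW : \dim W = (2 * n + m)%N).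
Hypothesis eggA : is_egg n m W A.
Local Notation q := #|F|.
Local Notation tangent_at := (is_tangent_at n m W A).
Local Notation aP := (affine_point W).
Local Notation tP := (tangent_point n m W A).
Local Notation aL := (affine_line n W A).
Local Notation inc := (@tgq_inc F V n m W A).
Implicit Types (E X D : {vspace V}) (x y z : aP) (l : aL) (U : tP).

Lemma ambient_hyp : \dim {:V} = (\dim W).+1.
Proof. by rewrite dimV dimW. Qed.
Local Notation rep := (rep ambient_hyp).

Lemma card_egg : #|A| = (q ^ m + 1)%N.
Proof. by case: eggA. Qed.

Lemma egg_sub E : E \in A -> (E <= W)%VS.
Proof. by case: eggA => _ h _ _ /h[]. Qed.

Lemma egg_dim E : E \in A -> \dim E = n.
Proof. by case: eggA => _ h _ _ /h[]. Qed.

Lemma tangent_sub E (U : {vspace V}) : tangent_at E U -> (E <= U)%VS.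
Proof. by case/and4P. Qed.

Lemma tangent_subW E (U : {vspace V}) : tangent_at E U -> (U <= W)%VS.
Proof. by case/and4P. Qed.

Lemma tangent_dim E (U : {vspace V}) : tangent_at E U -> \dim U = (n + m)%N.
Proof. by case/and4P=> _ _ /eqP. Qed.

Lemma tangent_cap E (U : {vspace V}) E' :
  tangent_at E U -> E' \in A -> E' != E -> (E' :&: U)%VS = 0%VS.
Proof.
by case/and4P=> _ _ _ /'forall_implyP h E'A E'E; apply/eqP/(implyP (h _ E'A)).
Qed.

(* tangent_space and egg_of are projections of opaque proofs, because         *)
(* unification is very slow when it can unfold them down to pick.             *)
Lemma ex_tangent_space :
  {T : {vspace V} -> {vspace V} | forall E, E \in A -> tangent_at E (T E)}.
Proof.
exists (fun E => odflt 0%VS [pick U | tangent_at E U]) => E EA.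
case: eggA => _ _ _ /(_ E EA)[U EU].
by case: pickP => [//|/(_ U)]; rewrite EU.
Qed.

Definition tangent_space := sval ex_tangent_space.
Local Notation T := tangent_space.

Lemma tangent_spaceP E : E \in A -> tangent_at E (T E).
Proof. exact: (svalP ex_tangent_space E). Qed.

Lemma egg_cap E1 E2 : E1 \in A -> E2 \in A -> E1 != E2 -> (E1 :&: E2)%VS = 0%VS.
Proof.
move=> A1 A2 neq; apply/eqP; rewrite -subv0.
rewrite -(tangent_cap (tangent_spaceP A2) A1 neq) capvS //.
exact: tangent_sub (tangent_spaceP A2).
Qed.

Lemma egg_dim2 E1 E2 : E1 \in A -> E2 \in A -> E1 != E2 ->
  \dim (E1 + E2) = (2 * n)%N.
Proof.
by move=> A1 A2 neq; rewrite dimv_disjoint_sum ?egg_cap // !egg_dim // mul2n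
  addnn.
Qed.

Lemma egg_cap3 E1 E2 E3 : E1 \in A -> E2 \in A -> E3 \in A ->
  E1 != E2 -> E1 != E3 -> E2 != E3 -> ((E1 + E2) :&: E3)%VS = 0%VS.
Proof.
move=> A1 A2 A3 n12 n13 n23; case: eggA => _ _ h _.
have d3 := h _ _ _ A1 A2 A3 n12 n13 n23.
apply/eqP; rewrite -dimv_eq0; apply/eqP.
by have := dimv_sum_cap (E1 + E2) E3; rewrite d3 egg_dim2 // (egg_dim A3); lia.
Qed.

Lemma mem_cap0 (X Y : {vspace V}) u : (X :&: Y)%VS = 0%VS -> u \in X ->
  u \in Y -> u = 0.
Proof.
by move=> XY uX uY; apply/eqP; rewrite -memv0 -XY memv_cap uX.
Qed.

(* In the quotient by E, the images of the other egg elements together with   *)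
(* any tangent space at E partition the nonzero vectors: they are disjoint,   *)
(* and their sizes add up.                                                    *)
Lemma tangent_partition E (U : {vspace V}) w : E \in A -> tangent_at E U ->
  w \in W -> w \notin E ->
  ((w \in U) + #|[set E' in A | (E' != E) && (w \in (E + E')%VS)]| = 1)%N.
Proof.
move=> EA EU wW wE.
pose B (v : finvect_type V) := [set E' in A | (E' != E) && ((v :
  V) \in (E + E')%VS)].
pose S : {set finvect_type V} := vset W :\: vset E.
pose f (v : finvect_type V) := ((v \in vset U) + #|B v|)%N.
have f_le1 v : v \in S -> (f v <= 1)%N.
  rewrite !inE => /andP[vE vW]; rewrite /f inE.
  have [vU|vU] := boolP (v \in U).
    suff -> : B v = set0 by rewrite cards0.
    apply/setP => E1; rewrite !inE; apply/negbTE;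
      apply: contraNN vE => /and3P[A1 n1].
    case/memv_addP=> e eE [e1 e1E1 vE].
    have e1U : e1 \in U by rewrite -(rpredDl _ (subvP (tangent_sub EU) e eE))
      -vE.
    by rewrite vE (mem_cap0 (tangent_cap EU A1 n1) e1E1 e1U) addr0 eE.
  rewrite add0n; apply/card_le1_eqP => E1 E2; rewrite !inE.
  case/and3P=> A1 n1 /memv_addP[e eE [e1 e1E1 vE1]] /and3P[A2 n2 v2].
  apply: contraNeq vE => n12.
  have e1s : e1 \in (E + E2)%VS.
    by rewrite -(rpredDl _ (subvP (addvSl _ _) e eE)) -vE1.
  rewrite vE1 (_ : e1 = 0) ?addr0 //.
  by apply: mem_cap0 e1s e1E1; apply: egg_cap3; rewrite // eq_sym.
have cardD X Y : (X <= Y)%VS ->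
  #|vset Y :\: vset X| = (q ^ \dim Y - q ^ \dim X)%N.
  move=> XY; rewrite cardsD (setIidPr _) ?card_vset //.
  by apply/subsetP => v; rewrite !in_vset; apply: (subvP XY).
have sumf : (\sum_(v in S) f v = #|S|)%N.
  rewrite big_split /= sum_mem_card.
  have -> : vset U :&: S = vset U :\: vset E.
    apply/setP => v; rewrite !inE andbCA; congr (_ && _).
    by apply: andb_idr; apply/subvP; apply: tangent_subW EU.
  have -> : (\sum_(v in S) #|B v| = \sum_(E' in A | E' != E) (q ^ (2 * n) - q ^
    n))%N.
    under eq_bigr => v _ do rewrite -sum1_card big_mkcond /=.
    rewrite exchange_big /= [RHS]big_mkcond; apply: eq_bigr => E' _.
    have [/andP[A' n']|nE'] := ifPn; last first.
      by rewrite big1 // => v _; rewrite inE andbA (negPf nE').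
    rewrite -(egg_dim2 EA A') 1?eq_sym // -(egg_dim EA) -cardD ?addvSl //.
    rewrite -sum1_card big_mkcond [RHS]big_mkcond; apply: eq_bigr => v _.
    rewrite !inE A' n' /=; case: (v \notin E) => //=.
    have [vE'|] := boolP (_ \in (E + E')%VS); last by case: ifP.
    have /subvP-> // : (E + E' <= W)%VS by rewrite subv_add !egg_sub.
  rewrite sum_nat_const cardD ?(tangent_sub EU) // cardD ?egg_sub //.
  rewrite (tangent_dim EU) dimW egg_dim //.
  have -> : #|[pred E' in A | E' != E]| = (q ^ m)%N.
    have := cardsD1 E A; rewrite EA card_egg addn1 add1n => -[->].
    by apply: eq_card => E'; rewrite !inE andbC.
  have q0 := card_field_gt0 F.
  have e1 : (q ^ (2 * n + m) = q ^ m * q ^ (2 * n))%N by rewrite expnD mulnC.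
  have e2 : (q ^ (n + m) = q ^ m * q ^ n)%N by rewrite expnD mulnC.
  have : (q ^ n <= q ^ (2 * n))%N by rewrite leq_pexp2l //; lia.
  have : (q ^ n <= q ^ (n + m))%N by rewrite leq_pexp2l //; lia.
  have : (q ^ m * q ^ n <= q ^ m * q ^ (2 * n))%N by rewrite leq_mul2l
    leq_pexp2l ?orbT //; lia.
  by rewrite mulnBr e1 e2; lia.
have : (\sum_(v in S) (1 - f v) = 0)%N.
  by rewrite sumnB // sumf sum1_card subnn.
have wS : (w : finvect_type V) \in S by rewrite !inE wE.
move/eqP; rewrite sum_nat_eq0 => /'forall_implyP/(_ w wS).
rewrite subn_eq0 => ge1; rewrite -(in_vset U) -/(B w) -/(f w).
by apply/eqP; rewrite eqn_leq ge1 f_le1.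
Qed.

(** By [tangent_partition], a vector of W outside E is in a tangent space at E exactly when it is in
    no E + E', a condition that does not mention U. *)
Lemma tangent_unique E (U : {vspace V}) : E \in A -> tangent_at E U -> U = T E.
Proof.
move=> EA EU; have ET := tangent_spaceP EA; apply/vspaceP => w.
have [wW|wW] := boolP (w \in W); last first.
  have notin X : (X <= W)%VS -> (w \in X) = false.
    by move=> /subvP XW; apply: contraNF wW => /XW.
  by rewrite !notin ?(tangent_subW ET) ?(tangent_subW EU).
have [wE|wE] := boolP (w \in E).
  by rewrite (subvP (tangent_sub EU)) // (subvP (tangent_sub ET)).
have := tangent_partition EA EU wW wE; have := tangent_partition EA ET wW wE.
by case: (w \in U); case: (w \in T E); lia.
Qed.


(** * Points of type (ii) and affine lines *)

Lemma ex_egg_of : {f : tP -> {vspace V} |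
  forall U, f U \in A /\ (val U :&: W)%VS = T (f U)}.
Proof.
exists (fun U : tP => odflt 0%VS [pick E in A | tangent_at E (val U :&: W)]) =>
  U.
case: pickP => [E /andP[EA EU] | no] /=; first by split=> //;
  apply: tangent_unique.
case/andP: (valP U) => _ /existsP[E /andP[EA EU]].
by have := no E; rewrite EA EU.
Qed.

Definition egg_of := sval ex_egg_of.

Lemma egg_ofP U : egg_of U \in A /\ (val U :&: W)%VS = T (egg_of U).
Proof. exact: (svalP ex_egg_of U). Qed.

Lemma egg_ofA U : egg_of U \in A. Proof. by case: (egg_ofP U). Qed.

Lemma tP_cap U : (val U :&: W)%VS = T (egg_of U). Proof. by case: (egg_ofP U).
  Qed.

Lemma tP_dim U : \dim (val U) = (n + m).+1.
Proof. by case/andP: (valP U) => /eqP. Qed.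

Lemma tP_notin U : ~~ (val U <= W)%VS.
Proof.
apply/negP => /capv_idPl UW; have := tP_dim U; rewrite -UW tP_cap.
by rewrite (tangent_dim (tangent_spaceP (egg_ofA U))) => /eqP;
  rewrite eqn_leq ltnn andbF.
Qed.

Lemma sub_egg_of E U : E \in A -> (E <= val U)%VS = (egg_of U == E).
Proof.
move=> EA; have tU := tangent_spaceP (egg_ofA U).
apply/idP/eqP => [EU | <-]; last first.
  by apply: subv_trans (tangent_sub tU) _; rewrite -tP_cap capvSl.
apply/eqP; apply: contraTT n_gt0; rewrite eq_sym => neq.
rewrite -(egg_dim EA) -eqn0Ngt dimv_eq0 -subv0 -(tangent_cap tU EA neq).
by rewrite subv_cap subvv -tP_cap subv_cap EU egg_sub.
Qed.

Lemma ex_tP x E : E \in A ->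
  exists U, [/\ val U = (val x + T E)%VS, egg_of U = E & (val x <= val U)%VS].
Proof.
move=> EA; have tE := tangent_spaceP EA; have TW := tangent_subW tE.
have capE : ((val x + T E) :&: W)%VS = T E := cap_join x TW.
have UP : (\dim (val x + T E) == (n + m).+1) &&
    is_tangent n m W A ((val x + T E) :&: W).
  rewrite (dim_join ambient_hyp) // (tangent_dim tE) eqxx capE /=.
  by apply/existsP; exists E; rewrite EA.
exists (Sub (val x + T E)%VS UP); split; rewrite ?addvSl //.
by apply/eqP; rewrite -sub_egg_of //= (subv_trans (tangent_sub tE)) ?addvSr.
Qed.

Lemma tP_inj x U1 U2 : (val x <= val U1)%VS -> (val x <= val U2)%VS ->
  egg_of U1 = egg_of U2 -> U1 = U2.
Proof.
move=> x1 x2 e12; apply: val_inj.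
by rewrite (join_cap ambient_hyp x1) (join_cap ambient_hyp x2) !tP_cap e12.
Qed.

(** Stated as an equality of predicates so that a sum over such U collapses to one term. *)
Lemma ex_tP_pred x E : E \in A -> exists2 U0, egg_of U0 = E &
  forall U, (egg_of U == E) && (val x <= val U)%VS = (U == U0).
Proof.
move=> EA; have [U0 [_ eU0 xU0]] := ex_tP x EA.
exists U0 => // U; apply/andP/eqP => [[/eqP eU xU] | ->].
  by apply: tP_inj xU xU0 _; rewrite eU.
by rewrite eU0 eqxx.
Qed.

Lemma card_tP U : #|[set x : aP | (val x <= val U)%VS]| = (q ^ (n + m))%N.
Proof.
have [x xU] := ex_aff ambient_hyp (tP_notin U).
rewrite (card_aff ambient_hyp xU) tP_cap.
by rewrite (tangent_dim (tangent_spaceP (egg_ofA U))).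
Qed.

(** Double counting of incident pairs: each of the q ^ (2n + m) affine points is in one tangent
    point at E, and each tangent point has q ^ (n + m) affine points. *)
Lemma card_tP_egg E : E \in A -> #|[set U : tP | egg_of U == E]| = (q ^ n)%N.
Proof.
move=> EA; have q0 := card_field_gt0 F.
apply/eqP; rewrite -(eqn_pmul2r (_ : 0 < q ^ (n + m))%N) ?expn_gt0 ?q0 //.
rewrite -sum_nat_const -expnD; apply/eqP.
under eq_bigr => U _ do rewrite -(card_tP U) -sum1_card big_mkcond /=.
rewrite exchange_big /=.
transitivity #|aP|; last first.
  by rewrite (card_aff_all ambient_hyp) dimW; congr (_ ^ _)%N; lia.
rewrite -sum1_card; apply: eq_bigr => x _.
have [U0 _ hU0] := ex_tP_pred x EA.
rewrite -big_mkcondr /= (big_pred1 U0) // => U; rewrite /= !inE; exact: hU0.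
Qed.

(** Tangent spaces at different elements span W, since one of them and the other egg element already
    do; so they meet in dimension m. *)
Lemma tP_meet U1 U2 x : egg_of U1 != egg_of U2 ->
  (val x <= val U1)%VS -> (val x <= val U2)%VS ->
  #|[set y : aP | (val y <= val U1)%VS && (val y <= val U2)%VS]| = (q ^ m)%N.
Proof.
move=> n12 x1 x2; have x12 :
  (val x <= val U1 :&: val U2)%VS by rewrite subv_cap x1.
under eq_finset do rewrite -subv_cap.
rewrite (card_aff ambient_hyp x12); congr (_ ^ _)%N.
have A1 := egg_ofA U1; have A2 := egg_ofA U2.
have t1 := tangent_spaceP A1; have t2 := tangent_spaceP A2.
have -> : (val U1 :&: val U2 :&: W = T (egg_of U1) :&: T (egg_of U2))%VS.
  by rewrite -!tP_cap -!capvA [in RHS](capv_idPr (capvSr _ _)).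
have sumW : (T (egg_of U1) + T (egg_of U2))%VS = W.
  apply/eqP; rewrite eqEdim subv_add (tangent_subW t1) (tangent_subW t2) /=.
  apply: leq_trans (dimvS (addvS (subvv _) (tangent_sub t2))).
  rewrite dimv_disjoint_sum; last by rewrite capvC (tangent_cap t1) // eq_sym.
  by rewrite (tangent_dim t1) (egg_dim A2) dimW; lia.
have := dimv_sum_cap (T (egg_of U1)) (T (egg_of U2)).
by rewrite sumW dimW (tangent_dim t1) (tangent_dim t2); lia.
Qed.

Definition direction (l : aL) : {vspace V} := (val l :&: W)%VS.

Lemma direction_egg l : direction l \in A.
Proof. by case/andP: (valP l). Qed.

Lemma ex_aff_line l : exists x : aP, (val x <= val l)%VS.
Proof.
apply: (ex_aff ambient_hyp); apply/negP => /capv_idPl lW.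
have := egg_dim (direction_egg l); rewrite /direction lW.
by case/andP: (valP l) => /eqP-> _ /eqP; rewrite eqn_leq ltnn.
Qed.

Lemma card_aff_line l : #|[set x : aP | (val x <= val l)%VS]| = (q ^ n)%N.
Proof.
have [x xl] := ex_aff_line l.
by rewrite (card_aff ambient_hyp xl) -/(direction l) (egg_dim (direction_egg
  l)).
Qed.

Lemma ex_line x E : E \in A -> exists l : aL, val l = (val x + E)%VS.
Proof.
move=> EA; have lP : (\dim (val x + E) == n.+1) && (((val x + E) :&: W)%VS \in
  A).
  rewrite (dim_join ambient_hyp) ?egg_sub // egg_dim // eqxx.
  by rewrite cap_join ?egg_sub.
by exists (Sub (val x + E)%VS lP).
Qed.

Lemma line_sub_tP l x U : (val x <= val l)%VS ->
  (val l <= val U)%VS = (egg_of U == direction l) && (val x <= val U)%VS.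
Proof.
move=> xl; rewrite -sub_egg_of ?direction_egg //.
by rewrite {1}(join_cap ambient_hyp xl) subv_add andbC.
Qed.

Lemma ex_tP_line l : exists2 U0, egg_of U0 = direction l &
  forall U, (val l <= val U)%VS = (U == U0).
Proof.
have [x xl] := ex_aff_line l.
have [U0 eU0 hU0] := ex_tP_pred x (direction_egg l).
by exists U0 => // U; rewrite (line_sub_tP U xl).
Qed.

(** * Dual codewords *)

Variable K : fieldType.
Hypothesis qK : #|F|%:R = 0 :> K.
Implicit Type (g : tgq_point n m W A -> K).

Lemma natr_q_exp k : (q ^ k)%:R = (k == 0)%:R :> K.
Proof. by rewrite natrX qK expr0n. Qed.

Lemma tgq_dual g (va : aP -> K) (vt : tP -> K) (vi : K) :
  code_function inc g ->
  (forall l, \sum_(x | (val x <= val l)%VS) va x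
             + \sum_(U | (val l <= val U)%VS) vt U = 0) ->
  (forall E, E \in A -> \sum_(U | egg_of U == E) vt U + vi = 0) ->
  \sum_x g (inl (inl x)) * va x + \sum_U g (inl (inr U)) * vt U
    + g (inr tt) * vi = 0.
Proof.
move=> gC Da Db.
pose v (P : tgq_point n m W A) :=
  match P with inl (inl x) => va x | inl (inr U) => vt U | inr _ => vi end.
have := @code_function_dual _ _ _ _ g v gC.
rewrite !big_sumType /= (big_pred1 tt); last by case.
apply => -[l | E]; rewrite !big_sumType /=.
  by rewrite Da big_pred0 ?addr0.
rewrite big_pred0 // add0r (big_pred1 tt); last by case.
rewrite -[RHS](Db (val E) (valP E)); congr (_ + _); apply: eq_bigl => U.
by rewrite sub_egg_of ?(valP E).
Qed.

Lemma natr_card_aff X x : (val x <= X)%VS ->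
  #|[set y : aP | (val y <= X)%VS]|%:R = ((X :&: W)%VS == 0%VS)%:R :> K.
Proof. by move=> xX; rewrite (card_aff ambient_hyp xX) natr_q_exp dimv_eq0. Qed.

Lemma sum_tP_const E (a : K) : E \in A -> \sum_(U | egg_of U == E) a = 0.
Proof.
move=> EA; rewrite sumr_const.
have -> : #|[pred U | egg_of U == E]| = (q ^ n)%N.
  by rewrite -(card_tP_egg  EA) cardsE.
by rewrite -mulr_natr natr_q_exp eqn0Ngt n_gt0 mulr0.
Qed.

(** The dual word is 1 on the affine points of X and -1 on the tangent points whose egg element
    misses X. If the direction of a line meets X, the line has 0 or a positive power of q affine
    points in X; otherwise it has exactly one, cancelled by its tangent point. *)
Lemma code_subspace_sum g X : code_function inc g ->
  \dim X = (n + m).+1 -> ~~ (X <= W)%VS ->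
  \sum_(x | (val x <= X)%VS) g (inl (inl x)) =
  \sum_(U | (egg_of U :&: X)%VS == 0%VS) g (inl (inr U)).
Proof.
move=> gC dX XW.
have := @tgq_dual g (fun x => (val x <= X)%VS%:R)
  (fun U => - ((egg_of U :&: X)%VS == 0%VS)%:R) 0 gC.
rewrite mulr0 addr0.
under eq_bigr => x _ do rewrite mulr_natr mulrb.
under [X in _ + X]eq_bigr => U _ do rewrite mulrN mulr_natr mulrb.
rewrite sumrN -!big_mkcond /= => dual.
apply/eqP; rewrite -subr_eq0; apply/eqP; apply: dual => [l | E EA]; last first.
  rewrite addr0 sumrN; apply/eqP; rewrite oppr_eq0; apply/eqP.
  by rewrite -[RHS](sum_tP_const ((E :&: X)%VS == 0%VS)%:R EA);
    apply: eq_bigr => U /eqP->.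
have [U0 eU0 hU0] := ex_tP_line  l.
rewrite (big_pred1 U0) // eU0; set E := direction l.
have EA : E \in A := direction_egg l.
have EW : (E <= W)%VS := egg_sub EA.
have -> : \sum_(x : aP | (val x <= val l)%VS) (val x <= X)%VS%:R =
    #|[set x : aP | (val x <= val l :&: X)%VS]|%:R :> K.
  rewrite -sum1_card natr_sum [RHS]big_mkcond [LHS]big_mkcond /=.
  by apply: eq_bigr => x _; rewrite inE subv_cap; case: (_ <= val l)%VS;
    case: (_ <= X)%VS.
have capE : (val l :&: X :&: W = E :&: X)%VS by rewrite -capvA (capvC X) capvA.
have [x0 x0l] := ex_aff_line l.
have [/existsP[x] | /existsPn no] := boolP [exists x :
  aP, (val x <= val l :&: X)%VS].
  by move/natr_card_aff->; rewrite capE subrr.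
rewrite (_ : [set _ | _] = set0); last first.
  by apply/setP => x; rewrite !inE (negPf (no x)).
rewrite cards0 sub0r; apply/eqP; rewrite oppr_eq0;
  have [E0|_] := eqVneq (E :&: X)%VS 0%VS; last by rewrite eqxx.
have [y0 y0X] := ex_aff ambient_hyp XW.
have sumW : (E + X :&: W)%VS = W.
  apply/eqP; rewrite eqEdim subv_add EW capvSr /=.
  rewrite dimv_disjoint_sum; last by rewrite capvA E0 cap0v.
  by move: (dim_cap_hyp ambient_hyp XW); rewrite dX dimW (egg_dim EA); lia.
have : rep y0 - rep x0 \in (E + X :&: W)%VS by rewrite sumW repB.
case/memv_addP=> e eE [d dX' eq_ed].
have [x xE] := ex_translate ambient_hyp x0 (subvP EW e eE).
case/negP: (no x); rewrite subv_cap (sub_aff ambient_hyp x x0l) (sub_aff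
  ambient_hyp x y0X).
have -> : rep x - rep x0 = e by rewrite xE addrC addKr.
have -> : rep x - rep y0 = - d.
  by rewrite xE -opprB; congr (- _); rewrite opprD addrA eq_ed addrC addKr.
by rewrite memvN dX' -/(direction l) eE.
Qed.

(** The dual word is the perp of P minus the perp of (oo); its affine part is paired with zeros of
    g. *)
Lemma code_perp_sum g (P : aP) : code_function inc g ->
  (forall x, g (inl (inl x)) = 0) ->
  \sum_(U | (val P <= val U)%VS) g (inl (inr U)) =
  \sum_U g (inl (inr U)) + g (inr tt).
Proof.
move=> gC g0.
pose vt (U : tP) : K := (val P <= val U)%VS%:R - 1.
(* The sum over A is the indicator of the points collinear with P: egg elements are disjoint, and at
   x = P the count q ^ m + 1 is 1 in K. *)
have := @tgq_dual g
  (fun x => \sum_(E in A) ((rep x - rep P \in E)%:R : K)) vt (-1) gC.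
rewrite big1 ?add0r; last by move=> x _; rewrite g0 mul0r.
under eq_bigr => U _ do rewrite mulrBr mulr1 mulr_natr mulrb.
rewrite sumrB -big_mkcond /= mulrN1 => dual.
apply/eqP; rewrite -subr_eq0 opprD addrA; apply/eqP; apply: dual => [l | E EA].
  have [U0 eU0 hU0] := ex_tP_line l; rewrite (big_pred1 U0) // {}/vt.
  have [x1 x1l] := ex_aff_line l.
  pose E0 := direction l; have E0A : E0 \in A := direction_egg l.
  have E0W := egg_sub E0A.
  pose w := rep x1 - rep P.
  have PU0 : (val P <= val U0)%VS = (w \in T E0).
    have x1U : (val x1 <= val U0)%VS.
      by apply: subv_trans x1l _; rewrite hU0.
    by rewrite (sub_aff ambient_hyp P x1U) tP_cap eU0 -memvN opprB.
  have Pl : (val P <= val l)%VS = (w \in E0).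
    by rewrite (sub_aff ambient_hyp P x1l) -memvN opprB.
  have mem_pt x E : (val x <= val l)%VS -> rep x - rep P \in E ->
    w \in (E0 + E)%VS.
    rewrite (sub_aff ambient_hyp x x1l) -/E0 => xl xE.
    have -> : w = - (rep x - rep x1) + (rep x - rep P).
      by rewrite opprB addrA subrK.
    by rewrite memv_add // memvN.
  rewrite exchange_big /= (bigD1 E0) //=.
  have count E : E \in A ->
    \sum_(x | (val x <= val l)%VS) (rep x - rep P \in E)%:R =
      #|[set x : aP | (val x <= val l :&: (val P + E))%VS]|%:R :> K.
    move=> EA; rewrite -sum1_card natr_sum [RHS]big_mkcond [LHS]big_mkcond /=.
    apply: eq_bigr => x _;
      rewrite inE subv_cap (sub_join ambient_hyp) ?egg_sub //.
    by case: (_ <= val l)%VS; case: (_ \in E).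
  have capE E : E \in A -> (val l :&: (val P + E) :&: W = E0 :&: E)%VS.
    move=> EA; rewrite -capvA cap_join ?egg_sub // /E0 /direction -capvA.
    by congr (_ :&: _)%VS; apply/esym/capv_idPr/egg_sub.
  (* For the direction of l itself, either all q ^ n points of l count or none. *)
  have -> : \sum_(x | (val x <= val l)%VS) (rep x - rep P \in E0)%:R = 0 :> K.
    have [wE0|wE0] := boolP (w \in E0); last first.
      rewrite big1 // => x xl; case: (boolP (_ \in E0)) => // xE.
      by have := mem_pt x E0 xl xE; rewrite addvv (negPf wE0).
    rewrite count // (natr_card_aff (x := P));
      last by rewrite subv_cap Pl wE0 addvSl.
    by rewrite capE // capvv -dimv_eq0 egg_dim // eqn0Ngt n_gt0.
  (* Any other E contributes one point if w is in E0 + E, and none otherwise. *)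
  have -> : \sum_(E in A | E != E0) \sum_(x | (val x <= val l)%VS) (rep x - rep
    P \in E)%:R
      = #|[set E in A | (E != E0) && (w \in (E0 + E)%VS)]|%:R :> K.
    rewrite -sum1_card natr_sum big_mkcond [RHS]big_mkcond;
      apply: eq_bigr => E _.
    rewrite inE andbA; case: ifP => //= /andP[EA nE]; rewrite count //.
    case: ifP => [|wE]; last first.
      rewrite -(count E EA) big1 // => x xl; case: (boolP (_ \in E)) => // xE.
      by have := mem_pt x E xl xE; rewrite wE.
    case/memv_addP=> e0 e0E0 [e eE wE].
    have ne0 : - e0 \in E0 by rewrite memvN.
    have [x xE] := ex_translate ambient_hyp x1 (subvP E0W _ ne0).
    have xle : (val x <= val l :&: (val P + E))%VS.
      rewrite subv_cap (sub_aff ambient_hyp x x1l) -/E0 (sub_join ambient_hyp)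
        ?egg_sub //.
      rewrite -/(direction l) xE [rep x1 - e0]addrC addrK ne0.
      by rewrite -addrA -/w wE addKr.
    by rewrite (natr_card_aff xle) capE // egg_cap ?eqxx // eq_sym.
  rewrite PU0 add0r.
  (* If P is on l, all q ^ m other elements count and P lies in U0; otherwise [tangent_partition]
     gives total 1. *)
  have [wE0|wE0] := boolP (w \in E0).
    rewrite (subvP (tangent_sub (tangent_spaceP E0A))) // subrr addr0.
    have -> : #|[set E in A | (E != E0) && (w \in (E0 + E)%VS)]| = (q ^ m)%N.
      have := cardsD1 E0 A; rewrite E0A card_egg addn1 add1n => -[->].
      apply: eq_card => E; rewrite !inE andbC.
      by rewrite (subvP (addvSl E0 E) w wE0) andbT.
    by rewrite natr_q_exp eqn0Ngt m_gt0.
  have := tangent_partition E0A (tangent_spaceP E0A) (repB ambient_hyp x1 P)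
    wE0.
  by move/(congr1 (fun k => k%:R : K)); rewrite natrD => e;
    rewrite addrA [X in X - 1]addrC e subrr.
have [U0 eU0 hU0] := ex_tP_pred P EA.
rewrite sumrB sum_tP_const // subr0; under eq_bigr do rewrite mulrb.
by rewrite -big_mkcondr /= (big_pred1 U0) ?subrr.
Qed.

(** * Codewords of small weight *)

Lemma weightE g : weight g =
  (#|[set x : aP | g (inl (inl x)) != 0%R]| + #|[set U :
    tP | g (inl (inr U)) != 0%R]|
   + (g (inr tt) != 0%R))%N.
Proof.
rewrite /weight -!sum1dep_card !big_sumType /=; congr (_ + _)%N.
by rewrite big_mkcond (big_pred1 tt) //; case: (_ != 0) || case=> //.
Qed.

Lemma weight_line L (a : K) : a != 0 ->
  weight (fun P => a * (inc P L)%:R) = (q ^ n + 1)%N.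
Proof.
move=> a0; have nz (b : bool) : (a * b%:R != 0) = b.
  by case: b; rewrite ?mulr1 ?mulr0 ?eqxx.
have -> : weight (fun P => a * (inc P L)%:R) =
    weight (fun P => (inc P L)%:R : K).
  by apply: eq_card => P; rewrite !inE nz; case: (inc P L);
    rewrite ?oner_eq0 ?eqxx.
have nz1 (b : bool) : ((b%:R : K) != 0) = b.
  by case: b; rewrite ?oner_eq0 ?eqxx.
rewrite weightE; case: L => [l | E] /=.
  have [U0 _ hU0] := ex_tP_line l.
  rewrite eqxx addn0 -(card_aff_line l); congr (_ + _)%N.
    by apply: eq_card => x; rewrite !inE nz1.
  by rewrite (_ : [set _ | _] = [set U0]) ?cards1 //; apply/setP => U;
    rewrite !inE nz1 hU0.
rewrite oner_eq0 (_ : [set _ | _] = set0); last first.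
  by apply/setP => x; rewrite !inE eqxx.
rewrite cards0 add0n -(card_tP_egg (valP E)); congr (_ + _)%N.
by apply: eq_card => U; rewrite !inE nz1 sub_egg_of ?(valP E).
Qed.

Lemma egg_cap_join E x D : E \in A -> (D <= W)%VS ->
  (E :&: (val x + D) = E :&: D)%VS.
Proof.
move=> EA DW; rewrite -{1}(capv_idPl (egg_sub EA)) -capvA (capvC W).
by rewrite cap_join.
Qed.

(** The right-hand side is free of x, so all translates of D have the same sum. *)
Lemma code_coset_sum g x D : code_function inc g ->
  (D <= W)%VS -> \dim D = (n + m)%N ->
  \sum_(y | (val y <= val x + D)%VS) g (inl (inl y)) =
  \sum_(U | (egg_of U :&: D)%VS == 0%VS) g (inl (inr U)).
Proof.
move=> gC DW dD; rewrite code_subspace_sum //.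
- by apply: eq_bigl => U; rewrite egg_cap_join ?egg_ofA.
- by rewrite (dim_join ambient_hyp) // dD.
- exact: (sub_W_aff ambient_hyp (addvSl _ _)).
Qed.

Lemma ex_aff_point : exists x : aP, true.
Proof.
have [|x _] := @ex_aff _ _ _ ambient_hyp fullv; last by exists x.
by apply/negP => /dimvS; rewrite ambient_hyp ltnn.
Qed.

Lemma two_eggs : exists E1 E2, [/\ E1 \in A, E2 \in A & E1 != E2].
Proof.
have /card_gt1P[E1 [E2 []]] : (1 < #|A|)%N; last by exists E1, E2.
by rewrite card_egg addn1 ltnS expn_gt0 card_field_gt0.
Qed.

(** * Codewords without affine support *)

Section SupportAtInfinity.

Variable g : tgq_point n m W A -> K.
Hypothesis gC : code_function inc g.
Hypothesis g_aff : forall x, g (inl (inl x)) = 0.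
Hypothesis g_wt : (weight g <= q ^ n + 1)%N.
Local Notation gt U := (g (inl (inr U))).
Local Notation supp := [set U : tP | gt U != 0].

Let sum_disjoint_egg D : (D <= W)%VS -> \dim D = (n + m)%N ->
  \sum_(U | (egg_of U :&: D)%VS == 0%VS) gt U = 0.
Proof.
move=> DW dD; have [x _] := ex_aff_point.
by rewrite -(code_coset_sum x gC DW dD) big1.
Qed.

(** Take D to be the tangent space at E: it misses exactly the other egg elements. *)
Let sum_egg E : E \in A -> \sum_(U | egg_of U == E) gt U = \sum_U gt U.
Proof.
move=> EA; have tE := tangent_spaceP EA.
rewrite [RHS](bigID (fun U => egg_of U == E)) /= -[LHS]addr0; congr (_ + _).
rewrite -[LHS](sum_disjoint_egg (tangent_subW tE) (tangent_dim tE)).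
apply: eq_bigl => U; have [->|neq] /= := eqVneq (egg_of U) E.
  rewrite (capv_idPl (tangent_sub tE)) -dimv_eq0 egg_dim //.
  by rewrite eqn0Ngt n_gt0.
by rewrite (tangent_cap tE) ?egg_ofA ?eqxx.
Qed.

Let card_supp : (#|supp| <= q ^ n + 1)%N.
Proof. by apply: leq_trans g_wt; rewrite weightE; lia. Qed.

(** If the total were nonzero, every egg element would carry a support point, forcing m <= n. A D
    inside E1 + E2 then meets E1 and E2 but no other element, so the total equals the sum of its
    parts at E1 and E2, that is, twice itself. *)
Let sum_tangent : \sum_U gt U = 0.
Proof.
apply/eqP/negP => /negP sum_neq0.
have le_mn : (m <= n)%N.
  have : (#|A| <= #|supp|)%N.
    apply: leq_trans (leq_imset_card egg_of _); apply/subset_leq_card/subsetP.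
    move=> E EA; have := sum_neq0; rewrite -(sum_egg EA) => sumE.
    have [/existsP[U /andP[/eqP EU gU]] | /existsPn no] :=
        boolP [exists U, (egg_of U == E) && (gt U != 0)].
      by apply/imsetP; exists U; rewrite ?inE.
    case/negP: sumE; apply/eqP/big1 => U EU.
    by apply/eqP; have := no U; rewrite EU negbK.
  rewrite card_egg => /leq_trans/(_ card_supp).
  by rewrite leq_add2r leq_exp2l ?card_field_gt1.
have [E1 [E2 [A1 A2 n12]]] := two_eggs.
have sW : (E1 + E2 <= W)%VS by rewrite subv_add !egg_sub.
(* The empty family only serves to obtain a subspace of dimension n + m; the codimension in E1 + E2
   is n - m. *)
have [D [DE dD] _] : exists2 D, (D <= E1 + E2)%VS /\ \dim D = (n + m)%N &
    forall i : 'I_0, i \in set0 -> (0 : V) \notin D.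
  have k0 : (#|(set0 : {set 'I_0})| * (q - 1) < q ^ (n - m).+1 - 1)%N.
    by rewrite cards0 mul0n subn_gt0 -{1}(expn0 q) ltn_exp2l ?card_field_gt1.
  apply: (subspace_avoiding k0) => [i|]; first by rewrite inE.
  by rewrite egg_dim2 //; lia.
have meetD E : E \in A -> (E <= E1 + E2)%VS -> ((E :&: D)%VS == 0%VS) = false.
  move=> EA EE; apply/negbTE; rewrite -dimv_eq0 -lt0n.
  have := dimv_sum_cap E D; rewrite (egg_dim EA) dD.
  have : (\dim (E + D) <= 2 * n)%N.
    by rewrite -(egg_dim2 A1 A2 n12) dimvS // subv_add EE.
  by lia.
have rest0 := sum_disjoint_egg (subv_trans DE sW) dD.
have : \sum_U gt U = \sum_U gt U + \sum_U gt U.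
  rewrite [LHS](bigID (fun U => egg_of U == E1)) /= sum_egg //; congr (_ + _).
  rewrite (bigID (fun U => egg_of U == E2)) /= -[RHS]addr0; congr (_ + _).
    rewrite -(sum_egg A2); apply: eq_bigl => U.
    by case: eqVneq => //= ->; rewrite (negPf n12).
  rewrite -[RHS]rest0; apply: eq_bigl => U; have UA := egg_ofA U.
  have [->|n1] := eqVneq (egg_of U) E1; first by rewrite meetD ?addvSl.
  have [->|n2] := eqVneq (egg_of U) E2; first by rewrite meetD ?addvSr.
  apply/esym/eqP/eqP; rewrite -subv0.
  rewrite -(egg_cap3 A1 A2 UA n12) 1?eq_sym // capvC capvS //.
by move=> /eqP; rewrite -subr_eq0 opprD addrA subrr sub0r oppr_eq0 (negPf
  sum_neq0).
Qed.

Let sum_through x : \sum_(U | (val x <= val U)%VS) gt U = g (inr tt).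
Proof. by rewrite code_perp_sum // sum_tangent add0r. Qed.

(* A tangent point U whose value differs from g (oo) would force, through     *)
(* each of its affine points, another tangent point in the support; each of   *)
(* these covers only q ^ m of the q ^ (n + m) affine points of U.             *)
Let tangent_const U0 U : gt U0 != 0 -> egg_of U = egg_of U0 ->
  gt U = g (inr tt).
Proof.
move=> gU0 eU; apply/eqP; apply: contraTT g_wt => neq.
pose S := [set U' : tP | (gt U' != 0) && (egg_of U' != egg_of U)].
have cover x : (val x <= val U)%VS ->
  exists2 U', U' \in S & (val x <= val U')%VS.
  move=> xU; have [/existsP[U' /and3P[nU gU' xU']] | /existsPn no] :=
      boolP [exists U', [&& U' != U, gt U' != 0 & (val x <= val U')%VS]].
    exists U' => //; rewrite inE gU'; apply: contraNN nU => /eqP eU'.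
    by apply/eqP; apply: tP_inj xU' xU eU'.
  case/eqP: neq; rewrite -(sum_through x) (bigD1 U) //= big1 ?addr0 // => U'.
  by case/andP=> xU' nU; apply/eqP; have := no U'; rewrite nU xU' andbT negbK.
have leS : (q ^ n <= #|S|)%N.
  rewrite -(@leq_pmul2r (q ^ m)) ?expn_gt0 ?card_field_gt0 //.
  rewrite -expnD -(card_tP U) -sum_nat_const.
  apply: leq_trans (_ : \sum_(U' in S)
      #|[set x : aP | (val x <= val U)%VS && (val x <= val U')%VS]| <= _)%N;
        last first.
    apply: leq_sum => U'; rewrite inE => /andP[_ nU'].
    have [/existsP[x /andP[xU xU']] | /existsPn no] :=
        boolP [exists x : aP, (val x <= val U)%VS && (val x <= val U')%VS].
      by rewrite (tP_meet _ xU xU') // eq_sym.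
    by rewrite (_ : [set _ | _] = set0) ?cards0 //; apply/setP => x;
      rewrite !inE (negPf (no x)).
  rewrite -sum1_card; under [leqRHS]eq_bigr =>
    U' _ do rewrite -sum1_card big_mkcond.
  rewrite exchange_big big_mkcond leq_sum // => x _; rewrite inE.
  case: ifP => // xU; have [U' U'S xU'] := cover x xU.
  by rewrite (bigD1 U') //= inE xU xU' leq_addr.
have suppS : supp = S :|: [set U' in supp | egg_of U' == egg_of U].
  by apply/setP => U'; rewrite !inE -andb_orr orNb andbT.
have disj : S :&: [set U' in supp | egg_of U' == egg_of U] = set0.
  by apply/setP => U'; rewrite !inE; case: (_ == egg_of U); rewrite ?andbF.
have := cardsUI S [set U' in supp | egg_of U' == egg_of U].
rewrite -suppS disj cards0 addn0 => cardS.
rewrite -ltnNge weightE cardS; set N := [set U' in supp | _] in cardS *.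
have NU0 : U0 \in N by rewrite !inE gU0 eU eqxx.
(* Two nonzero values outside S push the weight to q ^ n + 2. When g vanishes at (oo), the zero sum
   at this egg element supplies a second point besides U0. *)
suff : (2 <= #|N| + (g (inr tt) != 0%R))%N by lia.
have [gi0 | gi] := eqVneq (g (inr tt)) 0; last first.
  by rewrite addn1 ltnS card_gt0; apply/set0Pn; exists U0.
rewrite addn0 (cardsD1 U0) NU0 add1n ltnS card_gt0; apply/set0Pn.
have := sum_egg (egg_ofA U0); rewrite sum_tangent (bigD1 U0) //= => sum0.
have [/existsP[U' U'N] | /existsPn no] := boolP [exists U', U' \in N :\ U0].
  by exists U'.
case/eqP: gU0; rewrite -[LHS]addr0 -[RHS]sum0; congr (_ + _).
apply/esym/big1 => U' /andP[eU' nU']; apply/eqP.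
by have := no U'; rewrite !inE nU' eU eU' andbT negbK.
Qed.

(** By [tangent_const], the q ^ n tangent points at the egg element of one support point share the
    nonzero value at (oo); with (oo) they exhaust the weight. *)
Lemma line_of_support_at_infinity : (exists P, g P != 0) ->
  exists L a, a != 0 /\ forall P, g P = a * (inc P L)%:R.
Proof.
case=> P0 gP0.
have [U0 gU0] : exists U0, gt U0 != 0.
  case: P0 gP0 => [[x | U] | []] gP; first by rewrite g_aff eqxx in gP.
    by exists U.
  have [x _] := ex_aff_point.
  have [/existsP // | /existsPn no] := boolP [exists U, gt U != 0].
  case/eqP: gP; rewrite -(sum_through x) big1 // => U _.
  by apply/eqP; have := no U; rewrite negbK.
have constU0 U : egg_of U = egg_of U0 ->
  gt U = g (inr tt) by apply: tangent_const gU0.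
have gi : g (inr tt) != 0 by rewrite -(constU0 U0).
pose N := [set U : tP | egg_of U == egg_of U0].
have NE : N = supp.
  apply/eqP; rewrite eqEcard; apply/andP; split.
    by apply/subsetP => U; rewrite !inE => /eqP/constU0->.
  by rewrite card_tP_egg ?egg_ofA //; move: g_wt; rewrite weightE gi; lia.
exists (inr (Sub (egg_of U0) (egg_ofA U0))), (g (inr tt)); split=> //.
case=> [[x | U] | []] /=; rewrite ?g_aff ?mulr0 ?mulr1 //.
rewrite sub_egg_of ?egg_ofA //; have /setP/(_ U) := NE; rewrite !inE.
case: eqVneq => [/constU0-> // | _ /esym/negbFE/eqP->]; first by rewrite mulr1.
by rewrite mulr0.
Qed.

End SupportAtInfinity.

(** * Codewords with an affine support point *)

(** The q ^ n affine points of a line with direction E lie in pairwise distinct translates of D, and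
    S meets each. *)
Lemma transversal_card E D (S : {set aP}) : E \in A -> (D <= W)%VS ->
  (E :&: D)%VS = 0%VS ->
  (forall z, exists2 x, x \in S & (val x <= val z + D)%VS) -> (q ^ n <= #|S|)%N.
Proof.
move=> EA DW ED0 hit; have [z0 _] := ex_aff_point.
have [l lE] := ex_line z0 EA.
have lW : direction l = E by rewrite /direction lE cap_join ?egg_sub.
rewrite -(card_aff_line l) -!sum1_card.
apply: leq_trans (_ : \sum_(z in [set z : aP | (val z <= val l)%VS])
    \sum_(x in S) ((val x <= val z + D)%VS : nat) <= _)%N.
  apply: leq_sum => z _; have [x xS xz] := hit z.
  by rewrite (bigD1 x) //= xz leq_addr.
rewrite exchange_big /=; apply: leq_sum => x _.
rewrite -big_mkcondr /= sum1dep_card; apply/card_le1_eqP => z1 z2.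
rewrite !inE !(sub_join ambient_hyp) // => /andP[z1l x1] /andP[z2l x2].
apply: (@rep_inj _ _ _ ambient_hyp); apply/eqP; rewrite -subr_eq0; apply/eqP.
apply: (mem_cap0 ED0); first by rewrite -lW -(sub_aff ambient_hyp z2 z1l).
have -> : rep z2 - rep z1 = (rep x - rep z1) - (rep x - rep z2).
  by rewrite opprB [RHS]addrC subrKA.
by rewrite memvB.
Qed.

Lemma ex_complement E u : E \in A -> u \in W -> u \notin E ->
  exists D, [/\ (D <= W)%VS, \dim D = (n + m)%N, (E :&: D)%VS = 0%VS & u \in D].
Proof.
move=> EA uW uE; pose Z := (E + <[u]>)%VS; pose C := (W :\: Z)%VS.
have ZW : (Z <= W)%VS by rewrite subv_add egg_sub // -memvE.
have uZ : u \in Z by rewrite memvE addvSr.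
have u0 : u != 0 by apply: contraNneq uE => ->; rewrite mem0v.
have CZ : (C :&: Z)%VS = 0%VS by rewrite capv_diff.
have uC : u \notin C by apply: contra u0 => uC; rewrite (mem_cap0 CZ uC).
exists (C + <[u]>)%VS; split.
- by rewrite subv_add diffvSl -memvE.
- have := dimv_cap_compl W Z;
  rewrite (capv_idPr ZW) dimv_add_line // dimv_add_line //.
  by rewrite egg_dim // dimW -/C; lia.
- apply/eqP; rewrite -subv0; apply/subvP => e /memv_capP[eE].
  case/memv_addP=> d dC [_ /vlineP[k ->] eE'].
  have dZ : d \in Z.
    have -> : d = e - k *: u by rewrite eE' addrK.
    by rewrite memvB ?memvZ // (subvP (addvSl _ _) _ eE).
  rewrite eE' (mem_cap0 CZ dC dZ) add0r in eE *.
  have [->|k0] := eqVneq k 0; first by rewrite scale0r mem0v.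
  by case/negP: uE; rewrite -[u](scalerK k0) memvZ.
- by rewrite memvE addvSr.
Qed.

Section AffineSupport.

Variable g : tgq_point n m W A -> K.
Hypothesis gC : code_function inc g.
Hypothesis g_wt : (weight g <= q ^ n + 1)%N.
Local Notation ga x := (g (inl (inl x))).
Local Notation gt U := (g (inl (inr U))).
Local Notation suppA := [set x : aP | ga x != 0].
Local Notation suppT := [set U : tP | gt U != 0].

Lemma line_of_affine_support x0 : ga x0 != 0 ->
  exists L a, a != 0 /\ forall P, g P = a * (inc P L)%:R.
Proof.
move=> gx0; have x0S : x0 \in suppA by rewrite inE.
have q1 := card_field_gt1 F; have q0 := card_field_gt0 F.
have [D [DW dD] avoidD] : exists2 D, (D <= W)%VS /\ \dim D = (n + m)%N &
    forall x, x \in suppA :\ x0 -> rep x - rep x0 \notin D.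
  (* At most q ^ n other affine support points remain, and q ^ n * (q - 1) = q ^ n.+1 - q ^ n is
     below the bound. *)
  have cardJ : (#|suppA :\ x0| * (q - 1) < q ^ n.+1 - 1)%N.
    have leS : (#|suppA :\ x0| <= q ^ n)%N.
      by move: g_wt; rewrite weightE (cardsD1 x0) x0S; lia.
    apply: leq_ltn_trans (leq_mul leS (leqnn _)) _.
    have : (1 < q ^ n)%N by rewrite -(expn0 q) ltn_exp2l.
    have : (q ^ n <= q ^ n.+1)%N by rewrite leq_exp2l.
    by rewrite mulnBr muln1 -expnSr; lia.
  apply: (subspace_avoiding cardJ); last by rewrite dimW; lia.
  move=> x; rewrite in_setD1 => /andP[nx _]; rewrite subr_eq0.
  by apply: contraNneq nx => /(@rep_inj _ _ _ ambient_hyp)->.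
have sumD : \sum_(U | (egg_of U :&: D)%VS == 0%VS) gt U = ga x0.
  rewrite -(code_coset_sum x0 gC DW dD) (bigD1 x0) ?addvSl //= big1 ?addr0 //
    => x.
  rewrite (sub_join ambient_hyp) // => /andP[xD nx]; apply/eqP.
  by apply: contraTT xD => gx; apply: avoidD; rewrite !inE nx.
have [U0 /andP[/eqP U0D gU0]] :
    exists U, ((egg_of U :&: D)%VS == 0%VS) && (gt U != 0).
  have [/existsP //|/existsPn no] :=
    boolP [exists U, ((egg_of U :&: D)%VS == 0%VS) && (gt U != 0)].
  case/eqP: gx0; rewrite -sumD big1 // => U UD; apply/eqP.
  by have := no U; rewrite UD negbK.
pose E0 := egg_of U0; have E0A : E0 \in A := egg_ofA U0.
have hitS D' : (D' <= W)%VS -> \dim D' = (n + m)%N ->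
    \sum_(U | (egg_of U :&: D')%VS == 0%VS) gt U != 0 ->
  forall z, exists2 x, x \in suppA & (val x <= val z + D')%VS.
  move=> D'W dD' s0 z.
  have [/existsP[x /andP[xz gx]]|/existsPn no] :=
      boolP [exists x : aP, (val x <= val z + D')%VS && (ga x != 0)].
    by exists x; rewrite ?inE.
  case/negP: s0; rewrite -(code_coset_sum z gC D'W dD') big1 // => x xz.
  by apply/eqP; have := no x; rewrite xz negbK.
(* Together with U0 these points use up the whole weight. *)
have geS : (q ^ n <= #|suppA|)%N.
  by apply: (transversal_card E0A DW U0D); apply: hitS => //; rewrite sumD.
have U0T : U0 \in suppT by rewrite inE.
have cardS : #|suppA| = (q ^ n)%N.
  by move: g_wt; rewrite weightE (cardsD1 U0 suppT) U0T; lia.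
have /eqP suppT1 : suppT == [set U0].
  rewrite eq_sym eqEcard sub1set U0T cards1.
  by move: g_wt; rewrite weightE cardS; lia.
have gi : g (inr tt) = 0.
  apply/eqP; apply: contraTT g_wt => gi.
  by rewrite weightE cardS suppT1 cards1 gi; lia.
have gt0 U : U != U0 -> gt U = 0.
  move=> nU; apply/eqP; apply: contraNT nU => gU.
  by rewrite -in_set1 -suppT1 inE.
set b := gt U0 in gU0.
have sumb D' : (E0 :&: D')%VS = 0%VS ->
    \sum_(U | (egg_of U :&: D')%VS == 0%VS) gt U = b.
  move=> D'0; rewrite (bigD1 U0) /= ?big1 ?addr0 //; last by apply/eqP.
  by move=> U /andP[_ nU]; apply: gt0.
(* Two support points whose difference is outside E0 would lie in a common    *)
(* coset of a complement of E0, and one of them could be dropped.             *)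
have diffS x y : x \in suppA -> y \in suppA -> rep x - rep y \in E0.
  move=> xS yS; apply/negPn/negP => nE.
  have [D' [D'W dD' D'0 xyD]] := ex_complement E0A (repB ambient_hyp x y) nE.
  have nxy : y != x by apply: contraNneq nE => ->; rewrite subrr mem0v.
  suff : (q ^ n <= #|suppA :\ x|)%N.
    by rewrite -cardS (cardsD1 x) xS add1n ltnn.
  apply: (transversal_card E0A D'W D'0) => z.
  have [|w wS wz] := hitS D' D'W dD' _ z; first by rewrite sumb.
  have [wx | nwx] := eqVneq w x; last by exists w; rewrite // in_setD1 nwx.
  exists y; first by rewrite in_setD1 nxy.
  move: wz; rewrite wx !(sub_join ambient_hyp) // => xz.
  have -> : rep y - rep z = (rep x - rep z) - (rep x - rep y).
    by rewrite opprB [RHS]addrC subrKA.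
  by rewrite memvB.
have [l lE] := ex_line x0 E0A.
have lW : direction l = E0 by rewrite /direction lE cap_join ?egg_sub.
have suppl : suppA = [set x : aP | (val x <= val l)%VS].
  apply/eqP; rewrite eqEcard cardS card_aff_line leqnn andbT.
  apply/subsetP => x xS.
  by rewrite in_set lE (sub_join ambient_hyp) ?egg_sub // diffS.
(* The support lies in one coset of E0, so x is alone in its translate of D, whose sum is b for
   every x. *)
have gaE x : ga x = b * ((val x <= val l)%VS : bool)%:R.
  have /setP/(_ x) := suppl; rewrite !inE => <-.
  have [->|gx] := eqVneq (ga x) 0; first by rewrite mulr0.
  rewrite mulr1 -(sumb D U0D) -(code_coset_sum x gC DW dD).
  rewrite (bigD1 x) ?addvSl //= big1 ?addr0 // => y.
  rewrite (sub_join ambient_hyp) // => /andP[yD nyx]; apply/eqP.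
  apply: contraNT nyx => gy; apply/eqP/(@rep_inj _ _ _ ambient_hyp)/eqP.
  rewrite -subr_eq0; apply/eqP/(mem_cap0 U0D) => //.
  by apply: diffS; rewrite inE.
(* What remains is supported on at most U0 and the tangent point of l; if nonzero it would be a
   multiple of a line, of weight q ^ n + 1 > 2. *)
pose g' P := g P - b * (inc P (inl l))%:R.
have g'C : code_function inc g' by apply: code_function_sub_line.
have g'a x : g' (inl (inl x)) = 0 by rewrite /g' gaE subrr.
have [Ul _ hUl] := ex_tP_line l.
have wt' : (weight g' <= 2)%N.
  rewrite weightE (_ : [set x | _] = set0); last first.
    by apply/setP => x; rewrite !inE g'a eqxx.
  rewrite cards0 add0n /g' /= gi mulr0n mulr0 subrr eqxx addn0.
  apply: leq_trans (_ : #|[set U0; Ul]| <= 2)%N; last by rewrite cards2;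
    case: eqP.
  apply/subset_leq_card/subsetP => U; rewrite !inE /= hUl.
  have [//|nU0] := eqVneq U U0; rewrite gt0 //.
  by case: (U == Ul) => //=; rewrite mulr0 subrr eqxx.
have qn : (1 < q ^ n)%N by rewrite -(expn0 q) ltn_exp2l.
exists (inl l), b; split=> // P; apply/eqP; rewrite -subr_eq0.
apply: contraTT (wt') => g'P.
have [||L [a [a0 g'E]]] := line_of_support_at_infinity g'C g'a.
- by apply: leq_trans wt' _; lia.
- by exists P.
have -> : weight g' = weight (fun Q => a * (inc Q L)%:R).
  by apply: eq_card => Q; rewrite !inE g'E.
by rewrite weight_line // -ltnNge addn1 ltnS.
Qed.

End AffineSupport.

(** * Minimum weight codewords *)

Lemma small_weight_line (g : tgq_point n m W A -> K) : code_function inc g ->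
  (weight g <= q ^ n + 1)%N -> (exists P, g P != 0) ->
  exists L a, a != 0 /\ forall P, g P = a * (inc P L)%:R.
Proof.
move=> gC gw g0.
have [/existsP[x gx] | /existsPn no] := boolP [exists x :
  aP, g (inl (inl x)) != 0].
  exact: (line_of_affine_support gC gw gx).
apply: line_of_support_at_infinity => // x.
by apply/eqP; have := no x; rewrite negbK.
Qed.

Lemma hamming_weight_line L (a : K) : a != 0 ->
  hamming_weight (a *: incidence_vector K inc L) = (q ^ n + 1)%N.
Proof.
move=> a0; rewrite hamming_weight_function -(weight_line L a0).
by apply: eq_card => P; rewrite !inE mxE incidence_vectorE enum_rankK.
Qed.

Lemma scale_line_codeword L (a : K) :
  codeword inc (a *: incidence_vector K inc L).
Proof. by rewrite /codeword scalemx_sub ?row_sub. Qed.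

Lemma hamming_weight0 k : hamming_weight (0 : 'rV[K]_k) = 0%N.
Proof. by apply/eqP; rewrite cards_eq0; apply/eqP/setP => j;
  rewrite !inE mxE eqxx. Qed.

Lemma small_codeword_line (c : 'rV[K]_#|tgq_point n m W A|) :
  codeword inc c -> c != 0 -> (hamming_weight c <= q ^ n + 1)%N ->
  exists L a, a != 0 /\ c = a *: incidence_vector K inc L.
Proof.
move=> cC c0; rewrite hamming_weight_function => cw.
have [|L [a [a0 cE]]] := small_weight_line (codeword_function cC) cw.
  have [j cj] : exists j, c 0 j != 0 by apply/rV0Pn.
  by exists (enum_val j); rewrite enum_valK.
exists L, a; split=> //; apply/rowP => j.
by rewrite mxE incidence_vectorE -cE enum_valK.
Qed.

Lemma min_weight_codeword_lines (c : 'rV[K]_#|tgq_point n m W A|) :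
  min_weight_codeword inc c <->
  exists L a, a != 0 /\ c = a *: incidence_vector K inc L.
Proof.
have line0 L (a : K) : a != 0 -> a *: incidence_vector K inc L != 0.
  move=> a0; apply/eqP => l0; have := hamming_weight_line L a0.
  by rewrite l0 hamming_weight0 addn1.
split=> [[cC c0 cmin] | [L [a [a0 ->]]]].
  apply: small_codeword_line => //.
  have [E [_ [EA _ _]]] := two_eggs.
  pose L : tgq_line n W A := inr (Sub E EA).
  rewrite -(hamming_weight_line L (oner_neq0 K)); apply: cmin.
    exact: scale_line_codeword.
  exact: line0 (oner_neq0 K).
split; [exact: scale_line_codeword | exact: line0 |] => c' c'C c'0.
rewrite hamming_weight_line // leqNgt; apply/negP => lt_c'.
have [L' [a' [a'0 c'E]]] := small_codeword_line c'C c'0 (ltnW lt_c').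
by move: lt_c'; rewrite c'E hamming_weight_line // ltnn.
Qed.

End TranslationQuadrangle.

Theorem theorem4p5 (F : finFieldType) (V : vectType F) (n m p : nat)
    (W : {vspace V}) (A : {set {vspace V}})
    (n_gt0 : (0 < n)%N) (m_gt0 : (0 < m)%N)
    (dimV : \dim {:V} = (2 * n + m).+1) (dimW : \dim W = (2 * n + m)%N)
    (eggA : is_egg n m W A)
    (p_prime : prime p) (s_pow : exists k : nat, (#|F| ^ n = p ^ k)%N)
    (c : 'rV['F_p]_#|tgq_point n m W A|) :
  min_weight_codeword (@tgq_inc F V n m W A) c <->
  exists (l : tgq_line n W A) (a : 'F_p),
    a != 0 /\ c = a *: incidence_vector 'F_p (@tgq_inc F V n m W A) l.
Proof.
(* The exponent k is positive because q > 1 and n > 0; hence q vanishes in 'F_p. *)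
have p_dvd_q : (p %| #|F|)%N.
  have [k qnE] := s_pow.
  have : (p ^ 1 %| #|F| ^ n)%N.
    rewrite qnE dvdn_exp2l // lt0n; apply: contraTneq (card_field_gt1 F) => k0.
    by rewrite -leqNgt -(leq_exp2r _ _ n_gt0) exp1n qnE k0.
  by rewrite expn1 Euclid_dvdX // => /andP[].
have qK : #|F|%:R = 0 :> 'F_p.
  by apply/eqP; rewrite -(dvdn_pcharf (pchar_Fp p_prime)).
exact: min_weight_codeword_lines.
Qed.
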